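(* Let $\mathcal{G}=(\mathcal{V},\mathcal{E},\mathbf{W})$ be a connected signed weighted undirected graph with Laplacian matrix $L$, and let $\mathcal{E}_-\subseteq\mathcal{E}$ be the set of edges with negative weight. Then $L$ has at most $|\mathcal{E}_-|$ negative eigenvalues (counted with multiplicity).
   Context: $\mathcal{G}=(\mathcal{V},\mathcal{E},\mathbf{W})$ is a simple undirected connected graph with finite node set $\mathcal{V}$, $n=|\mathcal{V}|$, edge set $\mathcal{E}$, $l=|\mathcal{E}|$; each edge $(i,j)$ carries a nonzero real weight $w_{ij}$, positive or negative, and $\mathbf{W}\in\mathbb{R}^{l\times l}$ is the diagonal matrix of edge weights. With the edges arbitrarily oriented, $\mathbf{E}\in\mathbb{R}^{n\times l}$ is the incidence matrix (column of an edge from $i$ to $j$: entry $1$ in row $i$, $-1$ in row $j$, $0$ elsewhere). The Laplacian is $L=\mathbf{E}\mathbf{W}\mathbf{E}^T$. *)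

(* Defs.v *)
From mathcomp Require Import all_boot all_order all_algebra.
From mathcomp Require Import polyrcf.

Set Implicit Arguments.
Unset Strict Implicit.
Unset Printing Implicit Defensive.

Import GRing.Theory Num.Theory.
Local Open Scope ring_scope.

(* Simplicity is built in: an edge is a two-element set of nodes, so there are
   neither loops nor parallel edges.  The values of [weight] outside [edges]
   are irrelevant. *)
Record signed_graph (R : rcfType) (V : finType) := SignedGraph {
  edges : {set {set V}};
  weight : {set V} -> R;
  card_edge : forall e, e \in edges -> #|e| = 2%N;
  weight_neq0 : forall e, e \in edges -> weight e != 0
}.

Section SignedGraph.

Variables (R : rcfType) (V : finType) (G : signed_graph R V).

Definition adjacent : rel V := fun u v => [set u; v] \in edges G.

Definition connected_graph : Prop := forall u v, connect adjacent u v.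

Definition negative_edges : {set {set V}} :=
  [set e in edges G | weight G e < 0].

(* [o e = (i, j)] means that the edge [e] goes from [i] to [j]. *)
Definition orientation (o : {set V} -> V * V) : Prop :=
  forall e, e \in edges G -> e = [set (o e).1; (o e).2].

(* Rows are indexed by the enumeration of the nodes, columns by that of the
   edges. *)
Definition incidence_mx (o : {set V} -> V * V) :
    'M[R]_(#|V|, #|edges G|) :=
  \matrix_(i, k)
    let v := enum_val i in let e := enum_val k in
    if v == (o e).1 then 1 else if v == (o e).2 then -1 else 0.

Definition weight_mx : 'M[R]_#|edges G| :=
  diag_mx (\row_k weight G (enum_val k)).

Definition laplacian (o : {set V} -> V * V) : 'M[R]_#|V| :=
  incidence_mx o *m weight_mx *m (incidence_mx o)^T.

End SignedGraph.

(* Eigenvalues are the roots of the characteristic polynomial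
   (eigenvalue_root_char), counted with algebraic multiplicity; [rootsR] lists
   every root once. *)
Definition nb_neg_eigenvalues (R : rcfType) (n : nat) (A : 'M[R]_n) : nat :=
  (\sum_(a <- rootsR (char_poly A) | (a < 0)%R) mup a (char_poly A))%N.

(* Main.v *)
Require Import Defs.
From mathcomp Require Import all_boot all_order all_algebra.
From mathcomp Require Import polyrcf complex.

(** The Laplacian [E *m W *m E^T] is a congruence transform of a diagonal matrix,
    so the theorem is an instance of Sylvester's law of inertia: [B *m diag_mx w *m B^T] has at
    most as many negative eigenvalues as [w] has negative entries
    ([nb_neg_eigenvalues_congruence]), and the negative entries of the weight
    matrix are the weights of the negative edges.

    The spectral theorem over [R[i]] writes a real symmetric matrix [A] as
    [P^-1 *m diag_mx d *m P] with [P] unitary and [d] real.  As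
    [char_poly A] is then the product of the ['X - d_i], counting the negative
    eigenvalues with multiplicity amounts to counting the negative [d_i].  For
    [A = B *m diag_mx w *m B^T] this yields
    [diag_mx d = (P *m B) *m diag_mx w *m (P *m B) ^t*], and a dimension count
    compares the signs ([neg_diag_congruence_le]): on the vectors
    supported on the negative [d_i] the Hermitian form is negative definite, whereas it is nonnegative on
    the vectors killed by the columns of [P *m B] with negative [w_k].  If there
    were more negative [d_i] than negative [w_k], some nonzero vector would lie
    in both spaces. *)

Set Implicit Arguments.
Unset Strict Implicit.
Unset Printing Implicit Defensive.

Import Order.TTheory GRing.Theory Num.Theory.
Local Open Scope ring_scope.
Local Open Scope sesquilinear_scope.

Lemma hermitian_diagE (C : numClosedFieldType) (n : nat) (u d : 'rV[C]_n) :
  (u *m diag_mx d *m u ^t*) 0 0 = \sum_i d 0 i * `|u 0 i| ^+ 2.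
Proof.
rewrite mul_mx_diag mxE; apply: eq_bigr => i _.
by rewrite !mxE mulrAC normCK mulrC.
Qed.

(** The inertia inequality, between two diagonal forms.  If [d] had more negative
    entries than [w], the linear conditions (u B)_k = 0 for [w_k < 0] would be
    fewer than the coordinates [i] with [d_i < 0], so a nonzero [u] supported on
    these coordinates would satisfy them all; its value under the form would be
    both negative and nonnegative. *)
Lemma neg_diag_congruence_le (C : numClosedFieldType) (n l : nat)
    (B : 'M[C]_(n, l)) (d : 'rV[C]_n) (w : 'rV[C]_l) :
    diag_mx d = B *m diag_mx w *m B ^t* -> w \is a realmx ->
  (#|[set i | (d 0 i < 0)%R]| <= #|[set k | (w 0 k < 0)%R]|)%N.
Proof.
move=> dB w_real; set S := [set i | _]; set T := [set k | _].
rewrite leqNgt; apply/negP => ltTS.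
(* Vectors supported on [S] are represented as row vectors of length [#|S|]. *)
pose BS : 'M[C]_(#|S|, l) := rowsub (@enum_val _ (mem S)) B.
pose N : 'M[C]_(#|S|, #|T|) := colsub (@enum_val _ (mem T)) BS.
have /rowV0Pn[u uN u_neq0] : kermx N != 0.
  rewrite kermx_eq0 -row_leq_rank -ltnNge.
  exact: leq_ltn_trans (rank_leq_col _) ltTS.
have uN0 : u *m N = 0 by apply/sub_kermxP.
pose dS : 'rV[C]_#|S| := colsub (@enum_val _ (mem S)) d.
have dSB : diag_mx dS = BS *m diag_mx w *m BS ^t*.
  apply/matrixP => i j; have /matrixP/(_ (enum_val i) (enum_val j)) := dB.
  rewrite !mul_mx_diag !mxE (inj_eq enum_val_inj) => ->.
  by apply: eq_bigr => k _; rewrite !mxE.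
have uBS0 k : w 0 k < 0 -> (u *m BS) 0 k = 0.
  move=> wk; have kT : k \in T by rewrite inE.
  have /rowP/(_ (enum_rank_in kT k)) := uN0; rewrite !mxE => uN0k.
  rewrite -[RHS]uN0k; apply: eq_bigr => i _.
  by rewrite !mxE enum_rankK_in.
have : (u *m diag_mx dS *m u ^t*) 0 0 < 0.
  rewrite hermitian_diagE; have /rV0Pn[i ui_neq0] := u_neq0.
  have dS_lt0 j : dS 0 j < 0.
    by have := enum_valP j; rewrite inE mxE.
  rewrite (bigD1 i) //= ltr_wnDr //.
    by apply: sumr_le0 => j _; rewrite mulr_le0_ge0 ?exprn_ge0 // ltW.
  by rewrite nmulr_rlt0 // exprn_gt0 // normr_gt0.
suff /le_gtF -> : 0 <= (u *m diag_mx dS *m u ^t*) 0 0 by [].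
have -> : u *m diag_mx dS *m u ^t*
    = (u *m BS) *m diag_mx w *m (u *m BS) ^t*.
  by rewrite dSB trmx_mul map_mxM !mulmxA.
rewrite hermitian_diagE; apply: sumr_ge0 => k _.
have /mxOverP/(_ 0 k) wk_real := w_real.
have [wk_ge0|/uBS0 ->] := real_leP (real0 _) wk_real.
  by rewrite mulr_ge0 ?exprn_ge0.
by rewrite normr0 expr0n mulr0.
Qed.

Lemma char_poly_similar (R : comUnitRingType) (n : nat) (P A : 'M[R]_n) :
  P \in unitmx -> char_poly (invmx P *m A *m P) = char_poly A.
Proof.
move=> Pu; pose f m p := @map_mx _ _ (@polyC R) m p.
have fPK : f _ _ (invmx P) *m f _ _ P = 1%:M.
  by rewrite -map_mxM mulVmx // map_mx1.
rewrite /char_poly /char_poly_mx !map_mxM.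
have -> : 'X%:M - f _ _ (invmx P) *m f _ _ A *m f _ _ P
    = f _ _ (invmx P) *m ('X%:M - f _ _ A) *m f _ _ P.
  by rewrite mulmxBr mulmxBl scalar_mxC -[_%:M *m _ *m _]mulmxA fPK mulmx1.
by rewrite !det_mulmx mulrC mulrA -det_mulmx -map_mxM mulmxV // map_mx1 det1
  mul1r.
Qed.

(** The spectral theorem in the form needed for counting: diagonalising [A] by
    a congruence and computing [char_poly A] have to be done with the same [d].
    The matrix [P] is complex, which is harmless because the signs of a Hermitian
    form can be compared over [R[i]]. *)
Lemma symmetric_spectral (R : rcfType) (n : nat) (A : 'M[R]_n) :
    A^T = A ->
  exists (P : 'M[R[i]]_n) (d : 'rV[R]_n),
    diag_mx (map_mx (real_complex R) d)
      = P *m map_mx (real_complex R) A *m P ^t*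
    /\ char_poly A = \prod_i ('X - (d 0 i)%:P).
Proof.
move=> symA; set AC := map_mx _ A.
have hermA : AC \is hermsymmx.
  apply: realsym_hermsym.
    by apply/is_hermitianmxP; rewrite expr0 scale1r map_mx_id // map_trmx symA.
  by apply/mxOverP => i j; rewrite mxE; apply/complex_realP; exists (A i j).
have /hermitian_normalmx/orthomx_spectralP := hermA.
have := hermitian_spectral_diag_real hermA.
have Pu := spectral_unitarymx AC.
move: Pu; set P := spectralmx AC; set D := spectral_diag AC.
move=> Pu /mxOverP D_real defA.
have Punit := unitarymx_unit Pu.
exists P, (map_mx (@complex.Re R) D).
have -> : map_mx (real_complex R) (map_mx (@complex.Re R) D) = D.
  by apply/matrixP => i j; rewrite !mxE RRe_real.
split.
  by rewrite defA -(invmx_unitary Pu) !mulmxA mulmxV // mul1mx mulmxK.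
apply: (map_inj_poly (@complexI R) (rmorph0 _)).
rewrite map_char_poly -/AC defA char_poly_similar //.
rewrite char_poly_trig ?diag_mx_is_trig // rmorph_prod /=.
apply: eq_bigr => i _.
by rewrite rmorphB /= map_polyX map_polyC /= !mxE eqxx RRe_real.
Qed.

(** Multiplicities in a split polynomial are multiplicities in the list of its
    roots, so summing them over distinct points counts each entry of [s] at most
    once. *)
Lemma sum_mup_prod_XsubC_le (F : fieldType) (a : pred F) (r s : seq F) :
    uniq r ->
  (\sum_(x <- r | a x) mup x (\prod_(y <- s) ('X - y%:P)) <= count a s)%N.
Proof.
move=> uniq_r; under eq_bigr do rewrite mu_prod_XsubC.
elim: s => [|y s IHs] /=; first by rewrite big1.
rewrite big_split /= leq_add // -big_mkcondr.
rewrite sum1_count.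
have [ay|nay] := boolP (a y).
  apply: (@leq_trans (count_mem y r)); last by rewrite count_uniq_mem ?leq_b1.
  by apply: sub_count => x /= /andP[_]; rewrite eq_sym.
rewrite leqNgt -has_count; apply/hasPn => x _ /=.
by apply: contra nay => /andP[ax /eqP->].
Qed.

Lemma nb_neg_eigenvalues_congruence (R : rcfType) (n l : nat)
    (B : 'M[R]_(n, l)) (w : 'rV[R]_l) :
  (nb_neg_eigenvalues (B *m diag_mx w *m B^T) <= #|[set k | (w 0 k < 0)%R]|)%N.
Proof.
set A := B *m _ *m _.
have symA : A^T = A by rewrite !trmx_mul trmxK tr_diag_mx mulmxA.
have [P [d [diagd charA]]] := symmetric_spectral symA.
pose toC := real_complex R.
have -> : [set k | w 0 k < 0] = [set k | map_mx toC w 0 k < 0].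
  by apply/setP => k; rewrite !inE mxE -(ltcR _ 0).
apply: (@leq_trans #|[set i | map_mx toC d 0 i < 0]|); last first.
  apply: (@neg_diag_congruence_le _ _ _ (P *m map_mx toC B)).
    rewrite diagd !map_mxM map_diag_mx trmx_mul map_mxM !mulmxA.
    (* [B] has real entries, so its adjoint is its transpose. *)
    congr (_ *m _ *m _); apply/matrixP => i j; rewrite !mxE.
    by apply/esym/CrealP/complex_realP; eexists.
  by apply/mxOverP => i j; rewrite mxE; apply/complex_realP; eexists.
rewrite /nb_neg_eigenvalues charA -(big_map (d 0) xpredT (fun y => 'X - y%:P)).
apply: leq_trans (sum_mup_prod_XsubC_le _ _ (uniq_roots _ _ _)) _.
rewrite count_map cardsE cardE /enum_mem size_filter.
apply: eq_leq; apply: eq_count => i.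
by rewrite /= -topredE /= mxE -(ltcR _ 0).
Qed.

Theorem theorem7 (R : rcfType) (V : finType) (G : signed_graph R V)
    (o : {set V} -> V * V)
    (connG : connected_graph G) (orientG : orientation G o) :
  (nb_neg_eigenvalues (laplacian G o) <= #|negative_edges G|)%N.
Proof.
apply: leq_trans (nb_neg_eigenvalues_congruence _ _) _.
rewrite -(card_imset _ enum_val_inj); apply/subset_leq_card/subsetP => e.
case/imsetP => k; rewrite !inE mxE => wk ->.
by rewrite wk (enum_valP k).
Qed.
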